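(* Let $k\ge1$ and let $P=\langle\lambda,\mu\rangle$ be a plane partition of format $2\times(k+1)\times k$ with $P\subseteq\Delta$. There are $$(k+1-\lambda_1)\cdots(2-\lambda_k)\cdot(k-\mu_1)\cdots(2-\mu_{k-1})(1-\mu_k)$$ elements $(w,c)\in\mathcal C_{k+1}$ such that $w(i)\le k+1-\lambda_i$ and $wc(i)\le k+1-\mu_i$ for all $1\le i\le k$.
   Context: $\mathcal C_{k+1}\subseteq\mathfrak S_{k+1}\times\mathfrak S_{k+1}$ is the set of all ordered pairs $(\alpha,\beta)$ where $\alpha$ is an arbitrary element of $\mathfrak S_{k+1}$ and $\beta$ is a $(k+1)$-cycle. Products of permutations are compositions: $wc(i)=w(c(i))$. A plane partition $P=\langle\lambda,\mu\rangle$ of format $2\times(k+1)\times k$ is a pair of weakly decreasing sequences of integers $k+1\ge\lambda_1\ge\dots\ge\lambda_k\ge0$, $k+1\ge\mu_1\ge\dots\ge\mu_k\ge0$ with $\mu_j\le\lambda_j$ for all $j$. $P\subseteq\Delta$ means $\lambda_j\le k+1-j$ and $\mu_j\le k-j$ for all $1\le j\le k$. In the displayed product the factors are $k+2-i-\lambda_i$ and $k+1-i-\mu_i$ for $i=1,\dots,k$. *)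

(* Defs.v *)
From mathcomp Require Import all_boot all_fingroup.

Set Implicit Arguments.
Unset Strict Implicit.
Unset Printing Implicit Defensive.

(* Indices are 0-based throughout: the ordinal i stands for the point i.+1 of
   {1, ..., n}. *)

(* <lambda, mu>; the bound 0 <= _ is carried by the type nat. *)
Record plane_partition (k : nat) := PlanePartition {
  lambda : 'I_k -> nat;
  mu : 'I_k -> nat;
  lambda_bound : forall j : 'I_k, lambda j <= k.+1;
  mu_bound : forall j : 'I_k, mu j <= k.+1;
  lambda_decr : forall i j : 'I_k, i <= j -> lambda j <= lambda i;
  mu_decr : forall i j : 'I_k, i <= j -> mu j <= mu i;
  mu_le_lambda : forall j : 'I_k, mu j <= lambda j
}.

Definition sub_Delta (k : nat) (P : plane_partition k) : Prop :=
  forall j : 'I_k, lambda P j <= k.+1 - j.+1 /\ mu P j <= k - j.+1.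

Definition is_cycle (T : finType) (m : nat) (c : {perm T}) : bool :=
  [exists x, (#|porbit c x| == m) && perm_on (porbit c x) c].

Definition calC (n : nat) : {set 'S_n * 'S_n} :=
  [set p : 'S_n * 'S_n | is_cycle n p.2].

Definition inj_idx (k : nat) (i : 'I_k) : 'I_k.+1 := widen_ord (leqnSn k) i.

(* The composite wc is written as w (c i), because the product of permutations in
   perm applies its left factor first. *)
Definition satisfies_bounds (k : nat) (P : plane_partition k)
    (w c : 'S_k.+1) : bool :=
  [forall i : 'I_k,
    ((w (inj_idx i)).+1 <= k.+1 - lambda P i) &&
    ((w (c (inj_idx i))).+1 <= k.+1 - mu P i)].

(* Main.v *)
Require Import Defs.
From mathcomp Require Import all_boot all_fingroup.
From mathcomp Require Import zify.

(** Counting both w and, for fixed w, c is the same problem: count permutations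
    c with c(x_i) in S_i, where S_1, S_2, ... is an increasing chain and x_i is
    in S_i. For c, take S_i to be the preimage under w of the values at most
    k+1-mu_i; it contains i because w(i) <= k+1-lambda_i <= k+1-mu_i.

    Composing c with the transposition of x_1 and j = c(x_1) removes x_1 from its
    cycle. All S_i contain both x_1 and j, so the remaining conditions are
    unaffected: the reduced permutation is an arbitrary solution for
    x_2, x_3, ... with the sets S_i \ {x_1}. The choice of j is free in S_1, except
    that j <> x_1 if c has to be a full cycle. *)

Set Implicit Arguments.
Unset Strict Implicit.
Unset Printing Implicit Defensive.

Section RestrictedPermutations.

Local Open Scope group_scope.

Variable T : finType.
Implicit Types (c d : {perm T}) (x j z : T) (A : {set T}).

(** Multiplying by the transposition inserts the fixed point [x] into the cycle of [j], just before
    [j]; for [j != x] this merges two orbits into one. *)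
Lemma card_porbits_skip d x j : d x = x ->
  #|porbits d| = #|porbits (d * tperm x j)| + (j != x).
Proof.
(* With [y] the preimage of [j], conjugation by [d] moves the transposition to the left of [d], as
   [porbits_mul_tperm] requires. *)
move=> dx; set y := d^-1 j.
have dy : d y = j by rewrite /y permKV.
have -> : d * tperm x j = tperm x y * d.
  by rewrite -{1}dx -dy -tpermJ /conjg !mulgA mulgV mul1g.
have jx : (j != x) = (x != y).
  by rewrite -dy -{1}dx (inj_eq perm_inj) eq_sym.
have := porbits_mul_tperm d x y; rewrite /= jx.
have -> : (x \notin porbit d y) = (x != y).
  congr (~~ _); rewrite porbit_sym.
  apply/porbitP/eqP => [[i ->]|->]; last by exists 0; rewrite expg0 perm1.
  by rewrite permX iter_fix.
by case: (x != y) => /=; lia.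
Qed.

Lemma perm_on_skip A d x j : x \notin A -> j \in x |: A -> d x = x ->
  perm_on (x |: A) (d * tperm x j) = perm_on A d.
Proof.
move=> xA jA dx.
have tA : perm_on (x |: A) (tperm x j).
  by apply: subset_trans (tperm_on x j) _; rewrite subUset !sub1set setU11.
apply/idP/idP => [dtA|dA]; last first.
  by apply: perm_onM => //; apply: subset_trans dA (subsetUr _ _).
have : perm_on (x |: A) (d * tperm x j * tperm x j) by apply: perm_onM.
rewrite -mulgA tperm2 mulg1 => /subsetP dA.
apply/subsetP => u du; have := dA u du; rewrite !inE => /orP[/eqP ux|//].
by move: du; rewrite inE ux /= dx eqxx.
Qed.

(** The anchor [z] carries no constraint: it is the point that remains once every [p i] has been
    removed. *)
Definition anchored_range k (p : 'I_k -> T) z : {set T} := z |: [set p i | i : 'I_k].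

Lemma anchored_rangeS k (p : 'I_k.+1 -> T) z :
  anchored_range p z = p ord0 |: anchored_range (p \o lift ord0) z.
Proof.
rewrite /anchored_range setUCA; congr (_ |: _); apply/setP => u; rewrite !inE.
apply/imsetP/orP => [[i _ ->]|[/eqP ->|/imsetP[i _ ->]]]; last 2 first.
- by exists ord0.
- by exists (lift ord0 i).
case: (unliftP ord0 i) => [i' ->|->]; last by left.
by right; apply/imsetP; exists i'.
Qed.

(* Sending u to its orbit is injective off the range of p: apart from z these
   points are all fixed. *)
Lemma leq_card_porbits k (p : 'I_k -> T) z d :
  injective p -> perm_on (anchored_range p z) d -> #|T| <= #|porbits d| + k.
Proof.
move=> pI dA; set B := [set p i | i : 'I_k].
have cardB : #|B| = k by rewrite card_imset // card_ord.
have fixed u v : u \notin B -> u != z -> porbit d u = porbit d v -> u = v.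
  move=> uB uz uv; have du : d u = u.
    by apply: out_perm dA _; rewrite !inE (negbTE uz) (negbTE uB).
  have : v \in porbit d u by rewrite uv porbit_id.
  by case/porbitP=> i ->; rewrite permX iter_fix.
have -> : #|T| = #|~: B| + k by rewrite -{1}cardB addnC cardsC.
rewrite leq_add2r -(@card_in_imset _ _ (porbit d)).
  by apply/subset_leq_card/subsetP => _ /imsetP[u _ ->]; apply: imset_f.
move=> u v; rewrite !inE => uB vB uv.
have [uz|uz] := eqVneq u z; last exact: fixed.
have [vz|vz] := eqVneq v z; first by rewrite uz vz.
by apply/esym/fixed.
Qed.

(* When cyc holds, the orbit count forces the points p i and z onto a single
   cycle: no element of perm_on has fewer orbits. *)
Definition perm_over (cyc : bool) k (p : 'I_k -> T) z c :=
  perm_on (anchored_range p z) c && (cyc ==> (#|porbits c| + k == #|T|)).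

(** For [j] other than [p ord0], one orbit is lost and one point gained, so the cycle condition
    carries over. For [j] equal to it the orbit count is unchanged, and the lower bound for [d]
    makes the sum exceed [#|T|]. *)
Lemma perm_over_skip cyc k (p : 'I_k.+1 -> T) z d j :
  injective p -> p ord0 \notin anchored_range (p \o lift ord0) z ->
  j \in anchored_range p z -> d (p ord0) = p ord0 ->
  perm_over cyc p z (d * tperm (p ord0) j) =
  perm_over cyc (p \o lift ord0) z d && (cyc ==> (j != p ord0)).
Proof.
move=> pI xA jA dx; rewrite /perm_over.
have pI' : injective (p \o lift ord0) by apply: inj_comp pI (@lift_inj _ _).
rewrite anchored_rangeS perm_on_skip -?anchored_rangeS //.
case dA: (perm_on _ d) => //=; case: cyc => //=.
have := leq_card_porbits pI' dA; rewrite (card_porbits_skip j dx).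
by case: (j != _) => /=; lia.
Qed.

Definition restricted_perms cyc k (p : 'I_k -> T) (f : 'I_k -> {set T}) z :=
  [set c | perm_over cyc p z c & [forall i, c (p i) \in f i]].

Lemma card_restricted_permsS cyc k (p : 'I_k.+1 -> T) (f : 'I_k.+1 -> {set T}) z :
    injective p -> (forall i, p i != z) ->
    (forall i j : 'I_k.+1, i <= j -> f i \subset f j) -> (forall i, p i \in f i) ->
    (forall i, f i \subset anchored_range p z) ->
  #|restricted_perms cyc p f z| =
  ((#|f ord0| - cyc) *
   #|restricted_perms cyc (p \o lift ord0) (fun i => f (lift ord0 i) :\ p ord0) z|)%N.
Proof.
move=> pI pz fS pf fA; set x := p ord0.
have x_in i : x \in f i by apply: subsetP (pf ord0); apply: fS.
have xA : x \notin anchored_range (p \o lift ord0) z.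
  rewrite !inE (negbTE (pz _)) /=; apply/imsetP => -[i _ /pI].
  by move/(congr1 val).
set N := restricted_perms _ (p \o _) _ _.
pose J := if cyc then f ord0 :\ x else f ord0.
have -> : (#|f ord0| - cyc = #|J|)%N.
  by rewrite /J; case: (cyc); rewrite ?subn0 // (cardsD1 x (f ord0)) x_in addKn.
have JE j : (j \in J) = (j \in f ord0) && (cyc ==> (j != x)).
  by rewrite /J; case: (cyc); rewrite ?inE ?andbT // andbC.
have Nx d : d \in N -> d x = x.
  by rewrite inE => /andP[/andP[dA _] _]; apply: out_perm dA xA.
have stepE d j : d x = x -> j \in f ord0 ->
    (d * tperm x j \in restricted_perms cyc p f z) = (d \in N) && (j \in J).
  move=> dx jf; rewrite !inE perm_over_skip ?(subsetP (fA ord0)) // JE jf /=.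
  rewrite [LHS]andbAC; congr (_ && _ && _).
  have swap i u : (tperm x j u \in f i) = (u \in f i).
    have jfi : j \in f i by apply: subsetP jf; apply: fS.
    by case: tpermP => // ->; rewrite x_in jfi.
  (* Removing [x] from the later sets costs nothing: [d] fixes [x], so it sends no other point
     there. *)
  apply/forallP/forallP => dP i.
    have := dP (lift ord0 i); rewrite permM swap !inE => ->.
    by rewrite andbT -{1}dx (inj_eq perm_inj) (inj_eq pI).
  rewrite permM swap; case: (unliftP ord0 i) => [i' ->|->].
    by have := dP i'; rewrite !inE => /andP[].
  by rewrite -/x dx x_in.
(* The map from [(d, j)] to [d * tperm x j] is a bijection from [N] times [J]; [j] is recovered as
   the image of [x]. *)
rewrite mulnC -cardsX -(@card_in_imset _ _ (fun dj => dj.1 * tperm x dj.2)).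
  apply: eq_card => c; apply/idP/imsetP => [cR|[[d j] /setXP[dN jJ] ->]].
    pose d := c * tperm x (c x).
    have cE : c = d * tperm x (c x) by rewrite /d -mulgA tperm2 mulg1.
    have dx : d x = x by rewrite /d permM tpermR.
    have cxf : c x \in f ord0.
      by move: cR; rewrite inE => /andP[_ /forallP/(_ ord0)].
    exists (d, c x) => //; rewrite inE /= -stepE //.
    by rewrite -cE.
  by rewrite stepE ?dN ?Nx //; move: jJ; rewrite JE => /andP[].
move=> [d j] [d' j'] /setXP[dN jJ] /setXP[d'N j'J] /= eq_dj.
have jj' : j = j'.
  by have := congr1 (fun c : {perm T} => c x) eq_dj;
     rewrite !permM (Nx d) ?(Nx d') // !tpermL.
by move: eq_dj; rewrite jj' => /mulIg ->.
Qed.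

(** When [p i] is reached, [f i] has lost the [i] earlier points, all of which it contained by the
    chain condition. *)
Lemma card_restricted_perms cyc k (p : 'I_k -> T) (f : 'I_k -> {set T}) z :
    injective p -> (forall i, p i != z) ->
    (forall i j : 'I_k, i <= j -> f i \subset f j) -> (forall i, p i \in f i) ->
    (forall i, f i \subset anchored_range p z) ->
  #|restricted_perms cyc p f z| = (\prod_(i < k) (#|f i| - i - cyc))%N.
Proof.
elim: k p f => [|k IH] p f pI pz fS pf fA.
  rewrite big_ord0; apply/eqP/cards1P; exists 1; apply/setP => c.
  have A1 : anchored_range p z = [set z].
    apply/setP => u; rewrite !inE orbC.
    by case: imsetP => //= -[[]].
  rewrite !inE /perm_over A1; apply/idP/eqP => [/andP[/andP[cz _] _]|->].
    by apply: perm_on_id cz _; rewrite cards1.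
  rewrite perm_on1 /=; apply/andP; split; last by apply/forallP => -[].
  apply/implyP => _; rewrite addn0 /porbits card_imset // => u v uv.
  have : u \in porbit 1 v by rewrite -uv porbit_id.
  by case/porbitP => i ->; rewrite expg1n perm1.
have x_in i : p ord0 \in f i by apply: subsetP (pf ord0); apply: fS.
rewrite card_restricted_permsS // big_ord_recl subn0 IH.
- congr (_ * _)%N; apply: eq_bigr => i _.
  rewrite (cardsD1 (p ord0) (f (lift ord0 i))) x_in /= /bump /=.
  by rewrite add1n subSS.
- by apply: inj_comp pI (@lift_inj _ _).
- by move=> i; apply: pz.
- by move=> i j ij; apply: setSD; apply: fS; rewrite /= /bump !add1n ltnS.
- by move=> i; rewrite !inE pf andbT (inj_eq pI) eq_sym neq_lift.
- move=> i; rewrite subDset -anchored_rangeS; exact: fA.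
Qed.

End RestrictedPermutations.

Lemma is_cycle_full (T : finType) n (c : {perm T}) : 0 < n -> #|T| = n ->
  is_cycle n c = (#|porbits c| == 1).
Proof.
move=> n_gt0 cardT; apply/existsP/cards1P => [[x /andP[/eqP cx _]]|[A cA]].
  have xT : porbit c x = [set: T].
    by apply/eqP; rewrite eqEcard subsetT cardsT cx cardT leqnn.
  exists (porbit c x); apply/setP => B.
  apply/imsetP/set1P => [[y _ ->]|->]; last by exists x.
  by apply/eqP; rewrite eq_porbit_mem xT inE.
have /card_gt0P[x _] : 0 < #|T| by rewrite cardT.
exists x.
have xT : porbit c x = [set: T].
  apply/setP => y; rewrite inE -eq_porbit_mem.
  have : porbit c x \in porbits c by apply: imset_f.
  have : porbit c y \in porbits c by apply: imset_f.
  by rewrite cA => /set1P -> /set1P ->; rewrite eqxx.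
by rewrite xT cardsT cardT eqxx; apply/subsetP.
Qed.

Lemma card_ord_lt n m : m <= n -> #|[set u : 'I_n | u < m]| = m.
Proof.
by move=> mn; rewrite -sum1dep_card (big_ord_narrow mn) sum1_card card_ord.
Qed.

Theorem theorem4p9 (k : nat) (hk : 1 <= k) (P : plane_partition k)
    (hP : sub_Delta P) :
  #|[set p in calC k.+1 | satisfies_bounds P p.1 p.2]| =
  (\prod_(i < k) (k.+2 - i.+1 - lambda P i)) *
  (\prod_(i < k) (k.+1 - i.+1 - mu P i)).
Proof.
have pI : injective (@inj_idx k) by move=> i j /(congr1 val)/= /val_inj.
have pz (i : 'I_k) : inj_idx i != ord_max by rewrite -val_eqE /= ltn_eqF.
(* Anchoring at the last point, the only one without bounds, makes the support condition vacuous. *)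
have range_full : anchored_range (@inj_idx k) ord_max = setT.
  apply/setP => u; rewrite !inE; have [//|u_max] := eqVneq u ord_max.
  have uk : u < k by move: u_max (ltn_ord u); rewrite -val_eqE /=; lia.
  by apply/imsetP; exists (Ordinal uk) => //; apply: val_inj.
have subA (B : {set 'I_k.+1}) : B \subset anchored_range (@inj_idx k) ord_max.
  by rewrite range_full subsetT.
have on_range (c : 'S_k.+1) : perm_on (anchored_range (@inj_idx k) ord_max) c.
  by rewrite range_full; apply/subsetP => u; rewrite inE.
pose f (i : 'I_k) : {set 'I_k.+1} := [set u : 'I_k.+1 | u < k.+1 - lambda P i].
pose g (w : 'S_k.+1) (i : 'I_k) : {set 'I_k.+1} := w @^-1: [set u : 'I_k.+1 | u < k.+1 - mu P i].
pose W := restricted_perms false (@inj_idx k) f ord_max.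
pose C w := restricted_perms true (@inj_idx k) (g w) ord_max.
have cardW : #|W| = \prod_(i < k) (k.+2 - i.+1 - lambda P i).
  rewrite card_restricted_perms //.
  - by apply: eq_bigr => i _; rewrite card_ord_lt ?leq_subr //; lia.
  - move=> i j ij; apply/subsetP => u; rewrite !inE.
    by have := lambda_decr P ij; lia.
  (* This is where the bound on [lambda] from [sub_Delta] enters: it puts each point in its own
     set. *)
  - by move=> i; rewrite !inE /=; have [] := hP i; have := ltn_ord i; lia.
have cardC w : w \in W -> #|C w| = \prod_(i < k) (k.+1 - i.+1 - mu P i).
  rewrite inE => /andP[_ /forallP wW]; rewrite card_restricted_perms //.
  - apply: eq_bigr => i _; rewrite card_preimset; last exact: perm_inj.
    by rewrite card_ord_lt ?leq_subr //; lia.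
  - move=> i j ij; apply/subsetP => u; rewrite !inE.
    by have := mu_decr P ij; lia.
  - move=> i; have := wW i; rewrite !inE.
    by move=> /leq_trans -> //; apply: leq_sub2l; apply: mu_le_lambda.
have memE p : (p \in [set p in calC k.+1 | satisfies_bounds P p.1 p.2]) =
    (p.1 \in W) && (p.2 \in C p.1).
  case: p => w c; rewrite !inE /= /perm_over !on_range /=.
  have -> : is_cycle k.+1 c = (#|porbits c| + k == #|'I_k.+1|).
    rewrite (is_cycle_full c (ltn0Sn k) (card_ord _)).
    by move: #|porbits c| => N; rewrite card_ord -(add1n k) eqn_add2r.
  rewrite andbCA; congr (_ && _).
  apply/forallP/andP => [wcP|[/forallP wP /forallP cP] i].
      by split; apply/forallP => i; have /andP[] := wcP i; rewrite !inE.
    by have := wP i; have := cP i; rewrite !inE => -> ->.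
(* The right side becomes a sum over [w] in [W] of the constant [#|C w|], hence a count of pairs. *)
rewrite -cardW -sum_nat_const -sum1dep_card.
rewrite -(eq_bigr _ cardC).
under [RHS]eq_bigr do rewrite -sum1_card.
rewrite pair_big_dep /=; apply: eq_bigl => p.
by have := memE p; rewrite !inE.
Qed.
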